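(* $\mathcal{S}_{\mathrm{TEQ}}$ is directed if and only if $\mathcal{R}_{\mathrm{TEQ}}$ is directed. Moreover, if $\mathcal{R}_{\mathrm{TEQ}}$ is directed, then $\mathrm{TEQ}=\widehat{\mathrm{TEQ}}$, i.e. for every tournament $T$, $\mathrm{TEQ}(T)$ equals the union of all inclusion-minimal $\mathrm{TEQ}$-stable sets of $T$.
   Context: Let $X$ be a universe of alternatives. A tournament $T=(A,\succ)$: $A$ a non-empty finite subset of $X$, $\succ$ an asymmetric complete relation on $X$. For $B\subseteq A$ write $B$ also for $(B,\succ)$; $\overline{D}(b)=\{c\in A:c\succ b\}$; $\max_\prec(B)=\{a\in B:\text{no }b\in B\text{ with }b\succ a\}$. A tournament solution is a function $S$ on tournaments, depending only on $A$ and $\succ|_A$ and commuting with isomorphisms, with $\max_\prec(A)\subseteq S(T)\subseteq A$, $S(T)\ne\emptyset$. $B\subseteq A$ is $S$-stable in $T$ if $a\notin S(B\cup\{a\})$ for all $a\in A\setminus B$; $\mathcal{S}_S(T)$ is the set of $S$-stable sets; $\widehat{S}(T)$ is the union of the inclusion-minimal $S$-stable sets. $B\subseteq A$ is $S$-retentive in $T$ if $B\neq\emptyset$ and $S(\overline{D}(b))\subseteq B$ for every $b\in B$ with $\overline{D}(b)\neq\emptyset$; $\mathcal{R}_S(T)$ is the set of $S$-retentive sets. $\mathrm{TEQ}$ is defined recursively on the order of the tournament: $\mathrm{TEQ}(T)$ is the union of all inclusion-minimal $\mathrm{TEQ}$-retentive sets of $T$. A family-valued map $\mathcal{F}$ (such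 as $\mathcal{S}_{\mathrm{TEQ}}$ or $\mathcal{R}_{\mathrm{TEQ}}$) is directed if for every tournament $T$ and $B,C\in\mathcal{F}(T)$ there is $D\in\mathcal{F}(T)$ with $D\subseteq B\cap C$. *)

(* Defs.v *)
From mathcomp Require Import all_boot finmap.
From mathcomp Require Import boolp.

Set Implicit Arguments.
Unset Strict Implicit.
Unset Printing Implicit Defensive.

Local Open Scope fset_scope.

(** The dominance relation lives on the whole universe [X]; only the set of
    alternatives is finite.  [dominates T a b] reads "[a] beats [b]". *)
Record tournament (X : choiceType) := Tournament {
  alternatives : {fset X};
  dominates : rel X;
  alternatives_neq0 : alternatives != fset0;
  dominates_asym : forall a b, dominates a b -> ~~ dominates b a;
  dominates_complete : forall a b, a != b -> dominates a b || dominates b a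
}.

Section Definitions.
Variable X : choiceType.
Implicit Types (T : tournament X) (A B C D : {fset X}) (a b x : X).

Definition subtournament T B (B_neq0 : B != fset0) : tournament X :=
  @Tournament X B (dominates T) B_neq0
    (@dominates_asym X T) (@dominates_complete X T).

Definition dominators T b : {fset X} :=
  [fset c in alternatives T | dominates T c b].

Fact fset1U_neq0 a B : a |` B != fset0.
Proof. by apply/fset0Pn; exists a; rewrite fset1U1. Qed.

Definition family := tournament X -> {fset X} -> Prop.

Definition directed (F : family) : Prop :=
  forall T B C, F T B -> F T C -> exists2 D, F T D & D `<=` B `&` C.

Definition minimal_in (P : {fset X} -> Prop) B : Prop :=
  P B /\ forall C, P C -> C `<=` B -> C = B.

(** Filtering [alternatives T] loses nothing for the families below, whose
    members are all subsets of [alternatives T]. *)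
Definition union_minimal (F : family) T : {fset X} :=
  [fset x in alternatives T | `[< exists2 B, minimal_in (F T) B & x \in B >]].

Definition stable (S : tournament X -> {fset X}) : family := fun T B =>
  B `<=` alternatives T /\
  forall a, a \in alternatives T `\` B ->
    a \notin S (subtournament T (fset1U_neq0 a B)).

Definition retentive (S : tournament X -> {fset X}) : family := fun T B =>
  [/\ B `<=` alternatives T, B != fset0 &
      forall b, b \in B -> forall Db_neq0 : dominators T b != fset0,
        S (subtournament T Db_neq0) `<=` B].

Definition hat (S : tournament X -> {fset X}) : tournament X -> {fset X} :=
  union_minimal (stable S).

(** [n] is fuel bounding the order of the tournament: dominator sets are
    strictly smaller than the tournament, so the order itself is enough fuel,
    and [TEQE] gives the intended recursive equation. *)
Fixpoint TEQ_rec (n : nat) (T : tournament X) : {fset X} :=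
  if n is m.+1 then union_minimal (retentive (TEQ_rec m)) T else fset0.

Definition TEQ T : {fset X} := TEQ_rec #|` alternatives T| T.

Fact card_dominators T b : b \in alternatives T ->
  #|` dominators T b| < #|` alternatives T|.
Proof.
move=> bA; apply: fproper_ltn_card; rewrite fproperE; apply/andP; split.
  by apply/fsubsetP => c; rewrite !inE => /andP[].
apply/fsubsetPn; exists b => //; rewrite !inE bA /=.
by apply/negP => bb; have := dominates_asym bb; rewrite bb.
Qed.

Fact eq_union_minimal (F G : family) T :
  F T =1 G T -> union_minimal F T = union_minimal G T.
Proof. by move=> /funext FG; rewrite /union_minimal FG. Qed.

Fact eq_retentive (S S' : tournament X -> {fset X}) T :
  (forall b, b \in alternatives T -> forall h : dominators T b != fset0,
     S (subtournament T h) = S' (subtournament T h)) ->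
  retentive S T =1 retentive S' T.
Proof.
move=> SS' B; apply/propext; split=> -[BA B0 H]; split=> // b bB h.
  by rewrite -SS' ?H// (fsubsetP BA).
by rewrite SS' ?H// (fsubsetP BA).
Qed.

Fact TEQ_rec_fuel n T : #|` alternatives T| <= n -> TEQ_rec n T = TEQ T.
Proof.
rewrite /TEQ.
suff H m k U : #|` alternatives U| <= m -> #|` alternatives U| <= k ->
    TEQ_rec m U = TEQ_rec k U by move=> Tn; apply: H.
have U0 V : 0 < #|` alternatives V| by rewrite cardfs_gt0 alternatives_neq0.
elim: m k U => [|m IH] [|k] U; rewrite ?(leqNgt _ 0) ?U0//.
move=> Um Uk /=; apply: eq_union_minimal; apply: eq_retentive => b bU h.
have lt := card_dominators bU.
by apply: IH; rewrite -ltnS; apply: leq_trans lt _.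
Qed.

Lemma TEQE T : TEQ T = union_minimal (retentive TEQ) T.
Proof.
rewrite -(@TEQ_rec_fuel #|` alternatives T|.+1)//=.
apply: eq_union_minimal; apply: eq_retentive => b bT h.
exact/TEQ_rec_fuel/ltnW/card_dominators.
Qed.

End Definitions.

(* Main.v *)
(** When [retentive TEQ] is directed, [TEQ] of a tournament is its least
    retentive set, and induction on the order gives the strong superset
    property: [TEQ A `<=` B `<=` A] implies [TEQ B = TEQ A].  Hence [TEQ A] is
    stable.  If [B] is stable then [TEQ B] is retentive in [A], because the
    dominators of [b] in [B] are stable among its dominators in [A]; so [TEQ A]
    is the least stable set.  Conversely, for a tournament of minimal order with
    two disjoint retentive sets, the strong superset property holds below it and
    makes both sets stable, so stable sets are not directed either. *)
Require Import Defs.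
From mathcomp Require Import all_boot finmap.
From mathcomp Require Import boolp.

Set Implicit Arguments.
Unset Strict Implicit.
Unset Printing Implicit Defensive.

Local Open Scope fset_scope.

Lemma minimal_in_exists (X : choiceType) (P : {fset X} -> Prop) B :
  P B -> exists2 C, minimal_in P C & C `<=` B.
Proof.
have [n] := ubnP #|` B|; elim: n B => // n IH B ltBn PB.
case: (pselect (exists2 C, P C & C `<` B)) => [[C PC CB]|noC].
  have [|D minD DC] := IH C _ PC.
    by rewrite -ltnS; apply: leq_trans ltBn; rewrite ltnS fproper_ltn_card.
  by exists D => //; apply: fsubset_trans DC (fproper_sub CB).
exists B => //; split=> // C PC CB; apply/eqP; apply: contra_notT noC => CnB.
by exists C; rewrite // fproperEneq CnB.
Qed.

(** * Retentive and stable sets on subsets of a fixed tournament *)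

Section Restriction.
Variables (X : choiceType) (T : tournament X).
Implicit Types (A B C D : {fset X}) (a b : X).

(** The value [fset0] at [fset0] absorbs the nonemptiness guard in [retentive]. *)
Definition TEQ_on A : {fset X} :=
  if pselect (A != fset0) is left A0 then TEQ (subtournament T A0) else fset0.

Definition dominators_in A b : {fset X} := [fset c in A | dominates T c b].

(** [retentive_in], [stable_in] and [directed_in] take a plain set [A] in place of a subtournament,
    so that inductions pass to subsets without carrying nonemptiness proofs. *)
Definition retentive_in A B : Prop :=
  [/\ B `<=` A, B != fset0 &
      forall b, b \in B -> TEQ_on (dominators_in A b) `<=` B].

Definition stable_in A B : Prop :=
  B `<=` A /\ forall a, a \in A `\` B -> a \notin TEQ_on (a |` B).

Definition directed_in A : Prop := forall B C,
  retentive_in A B -> retentive_in A C ->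
  exists2 D, retentive_in A D & D `<=` B `&` C.

Lemma TEQ_onE A (A0 : A != fset0) : TEQ_on A = TEQ (subtournament T A0).
Proof. by rewrite /TEQ_on; case: pselect => // A0'; rewrite (bool_irrelevance A0 A0'). Qed.

Lemma TEQ_on0 : TEQ_on fset0 = fset0.
Proof. by rewrite /TEQ_on; case: pselect => // A0; exfalso; rewrite eqxx in A0. Qed.

Lemma retentive_subtournament A (A0 : A != fset0) :
  retentive (@TEQ X) (subtournament T A0) = retentive_in A.
Proof.
apply: funext => B; apply: propext; split=> -[BA B0 H]; split=> // b bB.
  have [->|D0] := eqVneq (dominators_in A b) fset0; first by rewrite TEQ_on0 fsub0set.
  by rewrite (TEQ_onE D0); apply: H bB D0.
by move=> D0; have := H b bB; rewrite (TEQ_onE D0).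
Qed.

Lemma stable_subtournament A (A0 : A != fset0) :
  stable (@TEQ X) (subtournament T A0) = stable_in A.
Proof.
apply: funext => B; apply: propext; split=> -[BA H]; split=> // a aAB.
  by rewrite (TEQ_onE (fset1U_neq0 a B)); apply: H.
by rewrite -TEQ_onE; apply: H.
Qed.

Lemma mem_TEQ_on A x : reflect (exists2 B, minimal_in (retentive_in A) B & x \in B)
  (x \in TEQ_on A).
Proof.
apply: (iffP idP) => [|[B minB xB]].
  have [->|A0] := eqVneq A fset0; first by rewrite TEQ_on0.
  by rewrite (TEQ_onE A0) TEQE !inE retentive_subtournament => /andP[_ /asboolP].
have [[BA _ _] _] := minB; have xA := fsubsetP BA _ xB.
have A0 : A != fset0 by apply/fset0Pn; exists x.
rewrite (TEQ_onE A0) TEQE !inE retentive_subtournament /= xA /=.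
by apply/asboolP; exists B.
Qed.

Lemma TEQ_on_sub A : TEQ_on A `<=` A.
Proof. by apply/fsubsetP => x /mem_TEQ_on[B [[BA _ _] _] /(fsubsetP BA)]. Qed.

Lemma dominators_in_sub A b : dominators_in A b `<=` A.
Proof. by apply/fsubsetP => c; rewrite !inE => /andP[]. Qed.

Lemma dominators_inS A B b : B `<=` A -> dominators_in B b `<=` dominators_in A b.
Proof. by move=> /fsubsetP BA; apply/fsubsetP => c; rewrite !inE => /andP[/BA-> ->]. Qed.

Lemma card_dominators_in A b : b \in A -> #|` dominators_in A b| < #|` A|.
Proof.
move=> bA; have A0 : A != fset0 by apply/fset0Pn; exists b.
exact: (@card_dominators X (subtournament T A0)).
Qed.

(** * Minimal and least retentive sets *)

Lemma retentive_in_self A : A != fset0 -> retentive_in A A.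
Proof.
by move=> A0; split=> // b _; apply: fsubset_trans (TEQ_on_sub _) (dominators_in_sub _ _).
Qed.

Lemma TEQ_on_neq0 A : A != fset0 -> TEQ_on A != fset0.
Proof.
move=> /retentive_in_self/minimal_in_exists[B minB _].
have [[_ /fset0Pn[x xB] _] _] := minB.
by apply/fset0Pn; exists x; apply/mem_TEQ_on; exists B.
Qed.

Lemma TEQ_on1 a : TEQ_on [fset a] = [fset a].
Proof.
apply/eqP; move: (TEQ_on_sub [fset a]); rewrite fsubset1 => /orP[//|].
by rewrite (negPf (TEQ_on_neq0 _)) //; apply/fset0Pn; exists a; rewrite inE.
Qed.

(** Consequently directedness can fail only through two disjoint retentive sets. *)
Lemma retentive_inI A B C : retentive_in A B -> retentive_in A C ->
  B `&` C != fset0 -> retentive_in A (B `&` C).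
Proof.
move=> [BA _ HB] [CA _ HC] BC0; split=> //.
  exact: fsubset_trans (fsubsetIl _ _) BA.
by move=> b; rewrite inE fsubsetI => /andP[bB bC]; rewrite HB ?HC.
Qed.

(** A minimal retentive set [M] lies below every retentive [B]: directedness gives a retentive
    subset of both, which minimality identifies with [M]. *)
Lemma TEQ_on_least A : directed_in A -> A != fset0 ->
  retentive_in A (TEQ_on A) /\ forall B, retentive_in A B -> TEQ_on A `<=` B.
Proof.
move=> dirA A0; have [M [retM minM] _] := minimal_in_exists (retentive_in_self A0).
have leM B : retentive_in A B -> M `<=` B.
  move=> retB; have [D retD] := dirA _ _ retM retB.
  by rewrite fsubsetI => /andP[DM DB]; rewrite -(minM D).
suff -> : TEQ_on A = M by [].
apply/fsetP => x; apply/mem_TEQ_on/idP => [[B [retB minB] xB]|xM]; last by exists M.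
by rewrite (minB M) // leM.
Qed.

(** Induction on the order of [A]. For [b] in [TEQ_on A], the dominators of [b] in [B] contain the
    [TEQ] of those in [A], so both dominator sets have the same [TEQ]. Retentiveness thus transfers
    between [A] and [B]. *)
Lemma TEQ_on_superset A B : (forall C, C `<=` A -> directed_in C) ->
  TEQ_on A `<=` B -> B `<=` A -> TEQ_on B = TEQ_on A.
Proof.
have [n] := ubnP #|` A|; elim: n A B => // n IH A B ltAn dir TB BA.
have [A0|A0] := eqVneq A fset0.
  by move: BA; rewrite A0 fsubset0 => /eqP->.
have [retA leA] := TEQ_on_least (dir _ (fsubset_refl A)) A0.
have B0 : B != fset0.
  by apply: contra (TEQ_on_neq0 A0) => /eqP B0; rewrite -fsubset0 -B0.
have [retB leB] := TEQ_on_least (dir _ BA) B0.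
have eqD b : b \in TEQ_on A ->
    TEQ_on (dominators_in B b) = TEQ_on (dominators_in A b).
  move=> bT; have bA := fsubsetP (TEQ_on_sub A) _ bT.
  apply: IH; last exact: dominators_inS.
  - by rewrite -ltnS; apply: leq_trans ltAn; rewrite ltnS card_dominators_in.
  - by move=> C CD; apply/dir/(fsubset_trans CD)/dominators_in_sub.
  - apply/fsubsetP => c cT; have := fsubsetP (TEQ_on_sub _) _ cT.
    have [_ _ /(_ b bT) sub] := retA.
    by rewrite !inE (fsubsetP TB) ?(fsubsetP sub) // => /andP[_ ->].
have TBA : TEQ_on B `<=` TEQ_on A.
  apply: leB; split=> //; first exact: TEQ_on_neq0.
  by move=> b bT; rewrite eqD //; have [_ _ ->] := retA.
(* The reverse inclusion uses the first: [eqD] applies to members of [TEQ_on B] because they lie in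
   [TEQ_on A]. *)
apply/eqP; rewrite eqEfsubset TBA /=; apply: leA; split.
- exact: fsubset_trans (TEQ_on_sub B) BA.
- exact: TEQ_on_neq0.
- by move=> b bT; rewrite -eqD ?(fsubsetP TBA) //; have [_ _ ->] := retB.
Qed.

(** * Stable sets and their relation to retentive sets *)

Lemma stable_in_neq0 A B : A != fset0 -> stable_in A B -> B != fset0.
Proof.
move=> /fset0Pn[a aA] [_ st]; apply/eqP => B0; move: st; rewrite B0.
by move=> /(_ a); rewrite fsetU0 TEQ_on1 !inE eqxx aA => /(_ isT).
Qed.

(** Adding an outside [a] to [TEQ_on A] gives a set between [TEQ_on A] and [A], so its [TEQ] is
    still [TEQ_on A]. *)
Lemma stable_in_TEQ_on A : (forall C, C `<=` A -> directed_in C) ->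
  stable_in A (TEQ_on A).
Proof.
move=> dir; split=> [|a]; first exact: TEQ_on_sub.
rewrite inE => /andP[aT aA]; rewrite (TEQ_on_superset dir) ?fsubsetUr //.
by rewrite fsubUset fsub1set aA TEQ_on_sub.
Qed.

Lemma TEQ_on_sub_stable A B : (forall C, C `<=` A -> directed_in C) ->
  stable_in A B -> TEQ_on A `<=` B.
Proof.
have [n] := ubnP #|` A|; elim: n A B => // n IH A B ltAn dir st.
have [->|A0] := eqVneq A fset0; first by rewrite TEQ_on0 fsub0set.
have [_ leA] := TEQ_on_least (dir _ (fsubset_refl A)) A0.
have B0 := stable_in_neq0 A0 st; have [BA stB] := st.
have [retB _] := TEQ_on_least (dir _ BA) B0.
suff retTB : retentive_in A (TEQ_on B).
  exact: fsubset_trans (leA _ retTB) (TEQ_on_sub B).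
split; [exact: fsubset_trans (TEQ_on_sub B) BA | exact: TEQ_on_neq0 | ].
move=> b bT; have bB := fsubsetP (TEQ_on_sub B) _ bT.
have bA := fsubsetP BA _ bB.
have dirD C : C `<=` dominators_in A b -> directed_in C.
  by move=> CD; apply/dir/(fsubset_trans CD)/dominators_in_sub.
(* If [TEQ] chose [a] from the dominators of [b] in [a |]
   B[, retentiveness at]b[would put]a[in]TEQ_on (a |[B)], against the stability of [B]. *)
have stD : stable_in (dominators_in A b) (dominators_in B b).
  split=> [|a]; first exact: dominators_inS.
  rewrite !inE => /andP[aDB /andP[aA ab]].
  have aB : a \notin B by move: aDB; rewrite ab andbT.
  have aBA : a |` B `<=` A by rewrite fsubUset fsub1set aA.
  have aT : a \notin TEQ_on (a |` B) by apply: stB; rewrite inE aB.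
  have eqT : TEQ_on B = TEQ_on (a |` B).
    apply: TEQ_on_superset; last exact: fsubsetUr.
      by move=> C CaB; apply/dir/(fsubset_trans CaB).
    apply/fsubsetP => x xT; have := fsubsetP (TEQ_on_sub _) _ xT.
    by rewrite !inE => /predU1P[xa|//]; rewrite xa (negPf aT) in xT.
  have [_ _ /(_ b)] := (TEQ_on_least (dir _ aBA) (fset1U_neq0 a B)).1.
  rewrite -eqT => /(_ bT).
  have -> : dominators_in (a |` B) b = a |` dominators_in B b.
    by apply/fsetP => x; rewrite !inE; case: eqP => // ->.
  by move=> sub; rewrite eqT in sub; apply: contra aT => /(fsubsetP sub).
have subD : TEQ_on (dominators_in A b) `<=` dominators_in B b.
  apply: IH => //; rewrite -ltnS; apply: leq_trans ltAn.
  by rewrite ltnS card_dominators_in.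
rewrite -(TEQ_on_superset dirD subD) ?dominators_inS //.
by have [_ _ ->] := retB.
Qed.

(** [B] stays retentive in [a |]
    B[; when this is a proper subset of]A[, its least retentive set lies in]B[and misses]a[. The set]C[settles the case]a
    |[B = A]. *)
Lemma retentive_in_stable A B C : (forall D, D `<` A -> directed_in D) ->
  retentive_in A B -> retentive_in A C -> B `&` C = fset0 -> stable_in A B.
Proof.
move=> dir [BA B0 retB] [CA /fset0Pn[c cC] retC] BC0; split=> // a.
have notBC x : x \in B -> x \in C -> False.
  by move=> xB xC; have := in_fset0 x; rewrite -BC0 inE xB xC.
rewrite inE => /andP[aB aA].
have aBA : a |` B `<=` A by rewrite fsubUset fsub1set aA.
have ltD b : b \in B -> dominators_in A b `<` A.
  move=> /(fsubsetP BA) bA; rewrite fproperEcard dominators_in_sub.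
  exact: card_dominators_in.
have dirD b : b \in B -> forall D, D `<=` dominators_in A b -> directed_in D.
  by move=> bB D DA; apply/dir/(fsub_proper_trans DA)/ltD.
have ret_aB : retentive_in (a |` B) B.
  split=> // [|b bB]; first exact: fsubsetUr.
  rewrite (TEQ_on_superset (dirD b bB)) ?retB ?dominators_inS //.
  apply/fsubsetP => x xT; have := fsubsetP (TEQ_on_sub _) _ xT.
  by rewrite !inE (fsubsetP (retB b bB)) // orbT => /andP[_ ->].
have [eqA|neA] := eqVneq (a |` B) A; last first.
  have aBltA : a |` B `<` A by rewrite fproperEneq neA.
  have [_ le] := TEQ_on_least (dir _ aBltA) (fset1U_neq0 a B).
  by apply: contra aB => /(fsubsetP (le _ ret_aB)).
(* Otherwise [C = [fset a]], so [a] is a Condorcet winner of [A]; but then no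
   set avoiding [a] is retentive. *)
exfalso.
have inC x : x \in C -> x = a.
  move=> xC; have := fsubsetP CA _ xC; rewrite -eqA !inE => /predU1P[//|xB].
  by case: (notBC x xB xC).
have aC : a \in C by rewrite -(inC c cC).
(* Otherwise [TEQ] of these dominators would meet [C], hence contain [a], and [a] would beat
   itself. *)
have Da : dominators_in A a = fset0.
  apply/eqP; apply: contraT => /TEQ_on_neq0/fset0Pn[x xT].
  have xa := inC x (fsubsetP (retC a aC) _ xT).
  have := fsubsetP (TEQ_on_sub _) _ xT; rewrite xa !inE => /andP[_ aa].
  by have := dominates_asym aa; rewrite aa.
have /fset0Pn[b bB] := B0.
have ab : dominates T a b.
  have /orP[//|ba] : dominates T a b || dominates T b a.
    by apply: dominates_complete; apply: contraNneq aB => ->.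
  by have := in_fset0 b; rewrite -Da !inE ba (fsubsetP BA).
have aD : a \in dominators_in A b by rewrite !inE aA.
have D0 : dominators_in A b != fset0 by apply/fset0Pn; exists a.
(* Then [TEQ] of the dominators of [b] is nonempty and inside [[fset a]], so retentiveness of [B] at
   [b] forces [a] into [B]. *)
have ret_a : retentive_in (dominators_in A b) [fset a].
  split; [by rewrite fsub1set | by apply/fset0Pn; exists a; rewrite inE | ].
  move=> x; rewrite inE => /eqP->.
  have /eqP-> : dominators_in (dominators_in A b) a == fset0.
    by rewrite -fsubset0 -Da dominators_inS ?dominators_in_sub.
  by rewrite TEQ_on0 fsub0set.
have [_ le] := TEQ_on_least (dir _ (ltD b bB)) D0.
have /fset0Pn[x xT] := TEQ_on_neq0 D0.
have := fsubsetP (le _ ret_a) _ xT; rewrite inE => /eqP xa.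
by move: aB; rewrite -xa (fsubsetP (retB b bB)).
Qed.

Lemma directed_in_of_stable A :
  (forall D B C, D != fset0 -> stable_in D B -> stable_in D C ->
     exists2 E, stable_in D E & E `<=` B `&` C) ->
  directed_in A.
Proof.
move=> dirS; have [n] := ubnP #|` A|; elim: n A => // n IH A ltAn B C retB retC.
have dir D : D `<` A -> directed_in D.
  move=> /fproper_ltn_card ltD; apply: IH.
  by rewrite -ltnS; apply: leq_trans ltAn.
have [BC0|BC0] := eqVneq (B `&` C) fset0; last first.
  by exists (B `&` C); [apply: retentive_inI|].
have stB := retentive_in_stable dir retB retC BC0.
have stC : stable_in A C by apply: retentive_in_stable dir retC retB _; rewrite fsetIC.
have A0 : A != fset0.
  by have [BA + _] := retB; apply: contraNneq => A0; rewrite -fsubset0 -A0.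
(* A stable set inside the empty intersection would be empty, which is impossible as [A] is
   nonempty. *)
have [E stE] := dirS A B C A0 stB stC.
by rewrite BC0 fsubset0 (negPf (stable_in_neq0 A0 stE)).
Qed.

End Restriction.

(** * Transfer to whole tournaments and conclusion *)

Lemma subtournament_alternatives (X : choiceType) (T : tournament X) :
  subtournament T (alternatives_neq0 T) = T.
Proof. by case: T. Qed.

Section Directed.
Variable X : choiceType.
Implicit Types T : tournament X.

Lemma retentiveE T : retentive (@TEQ X) T = retentive_in T (alternatives T).
Proof. by rewrite -{1}(subtournament_alternatives T) retentive_subtournament. Qed.

Lemma stableE T : stable (@TEQ X) T = stable_in T (alternatives T).
Proof. by rewrite -{1}(subtournament_alternatives T) stable_subtournament. Qed.

Lemma TEQ_TEQ_on T : TEQ T = TEQ_on T (alternatives T).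
Proof. by rewrite (TEQ_onE T (alternatives_neq0 T)) subtournament_alternatives. Qed.

Lemma directed_retentive_in T A : directed (retentive (@TEQ X)) -> directed_in T A.
Proof.
move=> dir B C retB retC; have A0 : A != fset0.
  by have [BA + _] := retB; apply: contraNneq => A0; rewrite -fsubset0 -A0.
by have := dir (subtournament T A0) B C; rewrite retentive_subtournament; apply.
Qed.

End Directed.

Theorem theorem7 (X : choiceType) :
  (directed (stable (@TEQ X)) <-> directed (retentive (@TEQ X))) /\
  (directed (retentive (@TEQ X)) ->
     forall T : tournament X, TEQ T = hat (@TEQ X) T).
Proof.
(* A least stable set is both a common lower bound for directedness and the only minimal stable
   set. *)
have leastS : directed (retentive (@TEQ X)) -> forall T : tournament X,
    stable (@TEQ X) T (TEQ T) /\ forall B, stable (@TEQ X) T B -> TEQ T `<=` B.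
  move=> dir T; rewrite stableE TEQ_TEQ_on; split.
    by apply: stable_in_TEQ_on => C _; apply: directed_retentive_in.
  by move=> B; apply: TEQ_on_sub_stable => C _; apply: directed_retentive_in.
split; first split.
- move=> dirS T; rewrite retentiveE; apply: directed_in_of_stable => D B C D0.
  by have := dirS (subtournament T D0) B C; rewrite stable_subtournament.
- move=> /leastS least T B C stB stC; have [stT leT] := least T.
  by exists (TEQ T); rewrite // fsubsetI !leT.
- move=> /leastS least T; have [stT leT] := least T.
  apply/fsetP => x; rewrite !inE; apply/idP/andP => [xT|[_ /asboolP]].
    split; first by have [TA _] := stT; apply: (fsubsetP TA).
    apply/asboolP; exists (TEQ T) => //; split=> // C stC CT.
    by apply/eqP; rewrite eqEfsubset CT leT.
  by case=> B [stB minB]; rewrite (minB _ stT) // leT.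
Qed.
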